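(* Let $r \geq 1$ and $N \geq 1$ be integers, let $F_r$ be the free group of rank $r$, and let $P \in M_N(\mathbb{Q}[F_r])$ be an $N\times N$ matrix with entries in the group-ring $\mathbb{Q}[F_r]$. Define $a_{P,n} = \mathrm{Tr}(P^n)$ for $n \geq 0$ and $R_P(z) = \sum_{n=0}^\infty a_{P,n} z^n$. Then $R_P(z)$ is an algebraic function: there is a nonzero polynomial $Q(y,z) \in \mathbb{Q}[y,z]$ with $Q(R_P(z),z) = 0$.
   Context: For a group $G$, the trace $\mathrm{Tr}:\mathbb{Q}[G]\to\mathbb{C}$ sends an element to its constant term, i.e. the coefficient of the identity element of $G$. It is extended to $M_N(\mathbb{Q}[G])$ by $\mathrm{Tr}(P) = \sum_{j=1}^N \mathrm{Tr}(P_{jj})$. The series $R_P(z)$ (the Green's function of $P$) converges in a neighborhood of $z=0$ since $|a_{P,n}|$ grows at most exponentially in $n$. *)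

(* Defs.v *)
From HB Require Import structures.
From mathcomp Require Import all_boot all_order all_algebra.
From mathcomp Require Import finmap polyXY.
From mathcomp.multinomials Require Import monalg.
From mathcomp Require Import classical_sets boolp reals topology normedtype.
From mathcomp Require Import sequences complex.

Set Implicit Arguments.
Unset Strict Implicit.
Unset Printing Implicit Defensive.

Import Order.TTheory GRing.Theory Num.Theory numFieldNormedType.Exports.

Local Open Scope ring_scope.

(* The free group F_r, as the group of reduced words. The pair (i, b) is the  *)
(* i-th generator if b = false, and its inverse if b = true.                  *)

Section FreeGroup.
Variable r : nat.

Definition letter : Type := ('I_r * bool)%type.
HB.instance Definition _ := Finite.on letter.

Implicit Types (x y : letter) (s t w : seq letter).

Definition letter_inv x : letter := (x.1, ~~ x.2).

Definition reduced s : bool := sorted (fun x y => y != letter_inv x) s.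

(* Reduced form of the word x :: s, for s reduced.                            *)
Definition word_cons x s : seq letter :=
  if s is y :: s' then if y == letter_inv x then s' else x :: s else [:: x].

Definition word_mul s t : seq letter := foldr word_cons t s.
Definition word_inv s : seq letter := rev (map letter_inv s).

Lemma letter_invK : involutive letter_inv.
Proof. by case=> i b; rewrite /letter_inv negbK. Qed.

Lemma letter_inv_eq x y : (letter_inv x == y) = (x == letter_inv y).
Proof. by rewrite -(inj_eq (inv_inj letter_invK)) letter_invK. Qed.

Lemma reduced_behead x s : reduced (x :: s) -> reduced s.
Proof. by case: s => //= y s /andP[]. Qed.

Lemma word_cons_reduced x s : reduced s -> reduced (word_cons x s).
Proof.
case: s => //= y s rs; case: eqP => [_|/eqP yx]; first exact: path_sorted rs.
by rewrite /reduced /= yx.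
Qed.

Lemma word_cons_path x s : reduced (x :: s) -> word_cons x s = x :: s.
Proof. by case: s => //= y s /andP[/negPf->]. Qed.

Lemma word_consVK x s : reduced s -> word_cons (letter_inv x) (word_cons x s) = s.
Proof.
case: s => [|y s] /= rs; first by rewrite letter_invK eqxx.
case: eqP rs => [-> rs|_ _] /=; last by rewrite letter_invK eqxx.
exact: word_cons_path rs.
Qed.

Lemma word_consKV x s : reduced s -> word_cons x (word_cons (letter_inv x) s) = s.
Proof. by move=> rs; rewrite -{1}[x]letter_invK word_consVK. Qed.

Lemma word_mul_reduced s t : reduced t -> reduced (word_mul s t).
Proof. by move=> rt; elim: s => //= x s /word_cons_reduced. Qed.

Lemma word_mul1 s : reduced s -> word_mul s [::] = s.
Proof.
elim: s => //= x s IHs rs; rewrite IHs ?(reduced_behead rs) //.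
exact: word_cons_path.
Qed.

Lemma word_mul_cons x s t :
  reduced t -> word_mul (word_cons x s) t = word_cons x (word_mul s t).
Proof.
case: s => //= y s rt; case: eqP => //= ->.
by rewrite word_consKV ?word_mul_reduced.
Qed.

Lemma word_mulA s t w :
  reduced w -> word_mul s (word_mul t w) = word_mul (word_mul s t) w.
Proof. by move=> rw; elim: s => //= x s ->; rewrite word_mul_cons. Qed.

Lemma word_inv_reduced s : reduced s -> reduced (word_inv s).
Proof.
rewrite /reduced /word_inv rev_sorted sorted_map; apply: sub_sorted => x y /=.
by rewrite (inj_eq (inv_inj letter_invK)) eq_sym -letter_inv_eq eq_sym.
Qed.

Lemma word_invK : involutive word_inv.
Proof.
by move=> s; rewrite /word_inv map_rev revK -map_comp (eq_map letter_invK) map_id.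
Qed.

Lemma word_mulV s : reduced s -> word_mul (word_inv s) s = [::].
Proof.
elim: s => //= x s IHs rs; rewrite /word_inv map_cons rev_cons -cats1.
rewrite /word_mul foldr_cat [X in foldr _ X _]/= eq_sym letter_invK eqxx.
exact/IHs/reduced_behead/rs.
Qed.

Record free_group := FreeGroup {
  word_of :> seq letter;
  _ : reduced word_of
}.
HB.instance Definition _ := [isSub for word_of].
HB.instance Definition _ := [Choice of free_group by <:].

Implicit Types g h k : free_group.

Definition free_one : free_group := @FreeGroup [::] isT.
Definition free_mul g h : free_group :=
  FreeGroup (word_mul_reduced g (valP h)).
Definition free_inv g : free_group := FreeGroup (word_inv_reduced (valP g)).

Lemma free_mulA : associative free_mul.
Proof. by move=> g h k; apply/val_inj/word_mulA/valP. Qed.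

Lemma free_mul1 : left_id free_one free_mul.
Proof. by move=> g; apply/val_inj. Qed.

Lemma free_mulr1 : right_id free_one free_mul.
Proof. by move=> g; apply/val_inj/word_mul1/valP. Qed.

Lemma free_mulVg : left_inverse free_one free_inv free_mul.
Proof. by move=> g; apply/val_inj/word_mulV/valP. Qed.

Lemma free_mulgV : right_inverse free_one free_inv free_mul.
Proof.
move=> g; apply/val_inj => /=; rewrite -{1}[val g]word_invK.
exact/word_mulV/word_inv_reduced/valP.
Qed.

HB.instance Definition _ := isGroup.Build free_group
  free_mulA free_mul1 free_mulr1 free_mulVg free_mulgV.

End FreeGroup.

(* The group ring R[G]. The additive group is that of {malg R[G]}, whose      *)
(* product is only available in the library for monoids without nontrivial    *)
(* units; hence an alias with its own convolution product.                    *)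

Definition group_ring (R : nzRingType) (G : groupType) : Type := {malg R[G]}.

Section GroupRing.
Variables (R : nzRingType) (G : groupType).

HB.instance Definition _ := GRing.Zmodule.on (group_ring R G).

Implicit Types (a b c : group_ring R G) (g h k : G).

Local Open Scope fset_scope.

Definition gr_one : group_ring R G := << 1 *g 1%g >>.

Definition gr_mul a b : group_ring R G :=
  \sum_(g <- msupp a) \sum_(h <- msupp b) << a@_g * b@_h *g (g * h)%g >>.

Lemma gr_mulw (d e : {fset G}) a b :
  msupp a `<=` d -> msupp b `<=` e ->
  gr_mul a b = \sum_(g <- d) \sum_(h <- e) << a@_g * b@_h *g (g * h)%g >>.
Proof.
move=> ad be; rewrite /gr_mul (big_fset_incl _ ad) /=.
  apply/eq_bigr=> g _; apply/big_fset_incl => // h _ /mcoeff_outdom ->.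
  by rewrite mulr0 monalgU0.
move=> g _ /mcoeff_outdom ag.
by rewrite big1 // => h _; rewrite ag mul0r monalgU0.
Qed.

Lemma gr_mul0l : left_zero 0 gr_mul.
Proof. by move=> a; rewrite /gr_mul msupp0 big_seq_fset0. Qed.

Lemma gr_mul0r : right_zero 0 gr_mul.
Proof.
by move=> a; rewrite /gr_mul big1 // => g _; rewrite msupp0 big_seq_fset0.
Qed.

Lemma gr_mulDl : left_distributive gr_mul +%R.
Proof.
move=> a b c; rewrite [in RHS](gr_mulw (fsubsetUl _ (msupp b)) (fsubset_refl _)).
rewrite [in RHS](gr_mulw (fsubsetUr (msupp a) _) (fsubset_refl _)).
rewrite (gr_mulw (msuppD_le _ _) (fsubset_refl _)) -big_split /=.
apply/eq_bigr=> g _; rewrite -big_split /=; apply/eq_bigr=> h _.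
by rewrite mcoeffD mulrDl monalgUD.
Qed.

Lemma gr_mulDr : right_distributive gr_mul +%R.
Proof.
move=> a b c; rewrite [in RHS](gr_mulw (fsubset_refl _) (fsubsetUl _ (msupp c))).
rewrite [in RHS](gr_mulw (fsubset_refl _) (fsubsetUr (msupp b) _)).
rewrite (gr_mulw (fsubset_refl _) (msuppD_le _ _)) -big_split /=.
apply/eq_bigr=> g _; rewrite -big_split /=; apply/eq_bigr=> h _.
by rewrite mcoeffD mulrDr monalgUD.
Qed.

Lemma gr_mulUU (x y : R) g h :
  gr_mul << x *g g >> << y *g h >> = << x * y *g (g * h)%g >>.
Proof. by rewrite (gr_mulw msuppU_le msuppU_le) !big_seq_fset1 !mcoeffUU. Qed.

Lemma gr_mul_suml I (s : seq I) (F : I -> group_ring R G) b :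
  gr_mul (\sum_(i <- s) F i) b = \sum_(i <- s) gr_mul (F i) b.
Proof.
exact: (big_morph (gr_mul^~ b) (fun a c => gr_mulDl a c b) (gr_mul0l b)).
Qed.

Lemma gr_mul_sumr I (s : seq I) (F : I -> group_ring R G) a :
  gr_mul a (\sum_(i <- s) F i) = \sum_(i <- s) gr_mul a (F i).
Proof. exact: (big_morph (gr_mul a) (gr_mulDr a) (gr_mul0r a)). Qed.

Lemma gr_mulEl a b :
  gr_mul a b = \sum_(g <- msupp a) gr_mul << a@_g *g g >> b.
Proof. by rewrite {1}[a]monalgE; apply: gr_mul_suml. Qed.

Lemma gr_mulEr a b :
  gr_mul a b = \sum_(g <- msupp b) gr_mul a << b@_g *g g >>.
Proof. by rewrite {1}[b]monalgE; apply: gr_mul_sumr. Qed.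

Lemma gr_mulA : associative gr_mul.
Proof.
move=> a b c; rewrite [LHS]gr_mulEl (gr_mulEl a b) gr_mul_suml.
apply/eq_bigr=> g _; rewrite (gr_mulEl b c) (gr_mulEr _ b).
rewrite gr_mul_sumr gr_mul_suml; apply/eq_bigr=> h _.
rewrite (gr_mulEr _ c) gr_mul_sumr [RHS]gr_mulEr; apply/eq_bigr=> k _.
by rewrite !gr_mulUU mulrA mulgA.
Qed.

Lemma gr_mul1l : left_id gr_one gr_mul.
Proof.
move=> a; rewrite gr_mulEr [RHS]monalgE; apply/eq_bigr=> g _.
by rewrite gr_mulUU mul1r mul1g.
Qed.

Lemma gr_mul1r : right_id gr_one gr_mul.
Proof.
move=> a; rewrite gr_mulEl [RHS]monalgE; apply/eq_bigr=> g _.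
by rewrite gr_mulUU mulr1 mulg1.
Qed.

Lemma gr_one_neq0 : gr_one != 0.
Proof. by rewrite monalgU_eq0 oner_neq0. Qed.

HB.instance Definition _ := GRing.Zmodule_isNzRing.Build (group_ring R G)
  gr_mulA gr_mul1l gr_mul1r gr_mulDl gr_mulDr gr_one_neq0.

Definition gr_trace a : R := a@_(1%g : G).

Definition mx_gr_trace N (P : 'M[group_ring R G]_N) : R :=
  \sum_(j < N) gr_trace (P j j).

End GroupRing.

Section Green.
Variables (G : groupType) (N : nat).
Implicit Type P : 'M[group_ring rat G]_N.

Definition trace_coef P (n : nat) : rat := mx_gr_trace (P ^+ n).

(* R[i]^o, rather than R[i], carries the topology of the complex plane.       *)
Definition green_series (R : realType) P (z : R[i]^o) : nat -> R[i]^o :=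
  series (fun n => ratr (trace_coef P n) * z ^+ n).

Definition green (R : realType) P (z : R[i]^o) : R[i]^o :=
  limn (green_series P z).

End Green.

(* Main.v *)
Require Import Defs.
From HB Require Import structures.
From mathcomp Require Import all_boot all_order all_algebra.
From mathcomp Require Import finmap polyXY qpoly.
From mathcomp.multinomials Require Import monalg.
From mathcomp Require Import classical_sets boolp reals topology normedtype.
From mathcomp Require Import sequences complex.
From mathcomp Require Import zify ring lra.

(* Let h be the function on F_r with values in column vectors that solves the
   resolvent equation h = delta + z P h, so that the trace series is read off at
   the identity. After adding states P only involves translations by letters, and
   the tree structure of F_r shows that h (x_1 ... x_k) = F_(x_1) ... F_(x_k) G,
   where the matrices F_x (first passage from 1 to x) and G satisfy a finite system
   of quadratic equations. A system x_i = c_i + z p_i(x) is eliminated by linear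
   algebra: perturbing it by z eps x_i^3 makes the leading terms the pure powers
   x_i^3, hence the finitely many short monomials span all monomials over
   Q[z, eps, 1 / (z eps)], and Cayley-Hamilton yields a polynomial relation for
   each linear form in the x_i; the largest power of eps is divided out before
   setting eps = 0. Formal series are replaced by elements of Q[z] / (z^m), with a
   relation that does not depend on m. The passage to the analytic function is an
   estimate of the norm sum |a_n| rho^n of polynomials. *)

Set Implicit Arguments.
Unset Strict Implicit.
Unset Printing Implicit Defensive.

Import Order.TTheory GRing.Theory Num.Theory numFieldNormedType.Exports.

Local Open Scope ring_scope.

(** * Elimination for cubic systems *)


Definition word_prod (A : comNzRingType) (I : Type) (x : I -> A) (s : seq I) : A :=
  \prod_(j <- s) x j.

Lemma word_prod_cat (A : comNzRingType) (I : Type) (x : I -> A) (s t : seq I) :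
  word_prod x (s ++ t) = word_prod x s * word_prod x t.
Proof. exact: big_cat. Qed.

Lemma rmorph_word_prod (A B : comNzRingType) (I : Type) (f : {rmorphism A -> B})
    (x : I -> A) (s : seq I) :
  f (word_prod x s) = word_prod (f \o x) s.
Proof. exact: rmorph_prod. Qed.

Lemma pigeonhole_seq (I : finType) n (s : seq I) :
  (n * #|I| < size s)%N -> exists i, (n < count_mem i s)%N.
Proof.
move=> ns; apply/existsP; apply: contraLR ns; rewrite negb_exists -leqNgt => /forallP sn.
have -> : size s = (\sum_(i : I) count_mem i s)%N.
  rewrite -sum1_size; under [RHS]eq_bigr do rewrite -sum1_count.
  rewrite (exchange_big_dep predT) //=; apply: eq_bigr => i _.
  by rewrite (big_pred1 i) // => j; rewrite /= eq_sym.
rewrite mulnC -sum_nat_const; apply: leq_sum => i _.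
by rewrite leqNgt.
Qed.

Section Elimination.
Variables (k : comNzRingType) (I : finType) (e : k) (T : I -> seq (k * seq I)).
Hypothesis T_quadratic : forall i t, t \in T i -> (size t.2 <= 2)%N.

(** A solution is bundled with the [k]-algebra where it lives, so that one relation can be asserted
    for all solutions at once. *)
Record cubic_sol := CubicSol {
  sol_ring : comNzRingType;
  sol_mor : {rmorphism k -> sol_ring};
  sol_pt : I -> sol_ring;
  sol_eq : forall i, sol_mor e * sol_pt i ^+ 3 =
    \sum_(t <- T i) sol_mor t.1 * word_prod sol_pt t.2
}.

Local Notation basis := ((2 * #|I|).-bseq I).

(** The exponent and the coefficients are uniform in the solution; a power of [e] is cleared because
    [e] need not be invertible. *)
Definition spanned (u : forall M : cubic_sol, sol_ring M) : Prop :=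
  exists n (d : basis -> k), forall M,
    sol_mor M e ^+ n * u M = \sum_b sol_mor M (d b) * word_prod (@sol_pt M) b.

Lemma eq_spanned u v : (forall M, u M = v M) -> spanned u -> spanned v.
Proof. by move=> uv [n [d ud]]; exists n, d => M; rewrite -uv. Qed.

Lemma spanned0 : spanned (fun=> 0).
Proof.
exists 0, (fun=> 0) => M; rewrite mulr0 big1 // => b _.
by rewrite rmorph0 mul0r.
Qed.

Lemma spanned_add u v : spanned u -> spanned v -> spanned (fun M => u M + v M).
Proof.
move=> [n [d ud]] [m [c vc]]; exists (n + m)%N, (fun b => e ^+ m * d b + e ^+ n * c b) => M.
rewrite mulrDr {1}addnC !exprD -!mulrA ud vc !mulr_sumr -big_split /=.
by apply: eq_bigr => b _; rewrite rmorphD !rmorphM !rmorphXn mulrDl !mulrA.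
Qed.

Lemma spanned_scale a u : spanned u -> spanned (fun M => sol_mor M a * u M).
Proof.
move=> [n [d ud]]; exists n, (fun b => a * d b) => M.
rewrite mulrCA ud mulr_sumr.
by apply: eq_bigr => b _; rewrite rmorphM mulrA.
Qed.

Lemma spanned_sum (J : eqType) (r : seq J) (u : J -> forall M, sol_ring M) :
  (forall j, j \in r -> spanned (u j)) -> spanned (fun M => \sum_(j <- r) u j M).
Proof.
elim: r => [_|j r IHr ur].
  by apply: eq_spanned spanned0 => M; rewrite big_nil.
apply: (@eq_spanned (fun M => u j M + \sum_(i <- r) u i M)).
  by move=> M; rewrite big_cons.
apply: spanned_add; first by apply: ur; rewrite mem_head.
by apply: IHr => i ir; apply: ur; rewrite in_cons ir orbT.
Qed.

Lemma spanned_unscale u : spanned (fun M => sol_mor M e * u M) -> spanned u.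
Proof.
by move=> [n [d ud]]; exists n.+1, d => M; rewrite exprSr -mulrA ud.
Qed.

(** A word of more than [2 * #|I|] letters contains some letter three times, and trading
    [e * x_i ^+ 3] for words of length at most two shortens it. *)
Lemma spanned_word s : spanned (fun M => word_prod (@sol_pt M) s).
Proof.
have [m] := ubnP (size s); elim: m => // m IHm in s * => sm.
have [sI|/pigeonhole_seq[i si]] := leqP (size s) (2 * #|I|).
  exists 0, (fun b : basis => (val b == s)%:R) => M.
  rewrite mul1r (bigD1 (Bseq sI)) //= eqxx rmorph1 mul1r big1 ?addr0 // => b bs.
  suff -> : (val b == s) = false by rewrite rmorph0 mul0r.
  by apply/negP => /eqP bE; case/negP: bs; apply/eqP/val_inj.
pose s1 := rem i s; pose s2 := rem i s1; pose s3 := rem i s2.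
have rem_count r : (0 < count_mem i r)%N -> count_mem i (rem i r) = (count_mem i r).-1.
  by move=> r0; rewrite count_rem -has_pred1 has_count r0 /= eqxx subn1.
have c1 : count_mem i s1 = (count_mem i s).-1.
  by apply: rem_count; apply: leq_trans si.
have c2 : count_mem i s2 = (count_mem i s1).-1.
  by apply: rem_count; rewrite c1; case: (count_mem i s) si => [|[|]].
have p1 : perm_eq s (i :: s1).
  by apply: perm_to_rem; rewrite -has_pred1 has_count; case: (count_mem i s) si.
have p2 : perm_eq s1 (i :: s2).
  apply: perm_to_rem; rewrite -has_pred1 has_count c1.
  by case: (count_mem i s) si => [|[|]].
have p3 : perm_eq s2 (i :: s3).
  apply: perm_to_rem; rewrite -has_pred1 has_count c2 c1.
  by case: (count_mem i s) si => [|[|[|]]].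
have sE (M : cubic_sol) :
    word_prod (@sol_pt M) s = @sol_pt M i ^+ 3 * word_prod (@sol_pt M) s3.
  rewrite /word_prod (perm_big _ p1) big_cons (perm_big _ p2) big_cons.
  rewrite (perm_big _ p3) big_cons /=.
  by rewrite exprS expr2 -!mulrA.
have ss : size s = (size s3).+3.
  by rewrite (perm_size p1) /= (perm_size p2) /= (perm_size p3).
apply: spanned_unscale.
apply: (@eq_spanned (fun M => \sum_(t <- T i)
    sol_mor M t.1 * word_prod (@sol_pt M) (t.2 ++ s3))).
  move=> M; rewrite sE mulrA sol_eq mulr_suml.
  by apply: eq_bigr => t _; rewrite word_prod_cat mulrA.
apply: spanned_sum => t tT; apply/spanned_scale/IHm.
rewrite size_cat; apply: leq_trans (_ : size s <= m)%N => //.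
by rewrite ss -[(size s3).+3]/(3 + size s3)%N -addSn leq_add2r ltnS (T_quadratic tT).
Qed.

(* Cayley-Hamilton: multiplication by e^n * \sum_(i in J) x_i maps the span of
   the short words into itself, with a matrix over k. *)
Lemma cubic_sol_integral (J : {pred I}) :
  exists n (p : {poly k}), p \is monic /\ forall M,
    (map_poly (sol_mor M) p).[sol_mor M e ^+ n * \sum_(i in J) sol_pt M i] = 0.
Proof.
pose y M := \sum_(i in J) sol_pt M i.
have yb (b : basis) : spanned (fun M => y M * word_prod (@sol_pt M) b).
  apply: (@eq_spanned (fun M => \sum_(i <- enum J)
      word_prod (@sol_pt M) (i :: b))).
    move=> M; rewrite big_enum /= mulr_suml; apply: eq_bigr => i _.
    by rewrite /word_prod big_cons.
  by apply: spanned_sum => i _; apply: spanned_word.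
have {yb} [nb /fin_all_exists[d yb]] := fin_all_exists yb.
pose n := (\sum_b nb b)%N.
pose bs (i : 'I_#|{: basis}|) : basis := enum_val i.
pose B := \matrix_(i, j) (e ^+ (n - nb (bs i)) * d (bs i) (bs j)).
exists n, (char_poly B); split=> [|M]; first exact: char_poly_monic.
set f := sol_mor M; set x := @sol_pt M; set a := f e ^+ n * _.
pose v := \col_i word_prod x (bs i).
have Bv : (a%:M - map_mx f B) *m v = 0.
  apply/matrixP => i j; rewrite mulmxBl mul_scalar_mx !mxE.
  apply/eqP; rewrite subr_eq0; apply/eqP.
  set b := bs i.
  have nE : n = (n - nb b + nb b)%N by rewrite subnK // /n (bigD1 b) //= leq_addr.
  rewrite -mulrA {1}nE exprD -mulrA yb mulr_sumr.
  rewrite (reindex bs) /=; last first.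
    by exists enum_rank => c _; rewrite /bs ?enum_valK ?enum_rankK.
  by apply: eq_bigr => c _; rewrite !mxE rmorphM rmorphXn mulrA.
have detE : (map_poly f (char_poly B)).[a] = \det (a%:M - map_mx f B).
  rewrite map_char_poly /char_poly -horner_evalE -det_map_mx.
  congr (\det _); apply/matrixP => i j.
  by rewrite !mxE /= horner_evalE hornerD hornerN hornerC hornerMn hornerX.
have := congr1 (mulmx (\adj (a%:M - map_mx f B))) Bv.
rewrite mulmxA mul_adj_mx mulmx0 detE mul_scalar_mx.
(* The coordinate of [v] at the empty word is 1, so the determinant vanishes even if the ring has
   zero divisors. *)
have h0 : (size (@nil I) <= 2 * #|I|)%N by [].
move/matrixP/(_ (enum_rank (Bseq h0)) 0); rewrite !mxE /bs enum_rankK.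
by rewrite /word_prod big_nil mulr1.
Qed.

End Elimination.

(** * Algebraicity of solutions of contracting quadratic systems *)


Section Contraction.
Variables (k A : comNzRingType) (I : Type) (f : {rmorphism k -> A}).
Variables (z : k) (c : I -> k) (T : I -> seq (k * seq I)).

Definition step (x : I -> A) (i : I) : A :=
  f (c i) + f z * \sum_(t <- T i) f t.1 * word_prod x t.2.

Definition zcong n (a b : A) := exists q, a - b = f z ^+ n * q.

Lemma zcong_refl n a : zcong n a a.
Proof. by exists 0; rewrite subrr mulr0. Qed.

Lemma zcong_add n a b a' b' : zcong n a b -> zcong n a' b' -> zcong n (a + a') (b + b').
Proof.
by move=> [q qE] [q' qE']; exists (q + q'); rewrite mulrDr -qE -qE' opprD addrACA.
Qed.

Lemma zcong_mul n a b a' b' : zcong n a b -> zcong n a' b' -> zcong n (a * a') (b * b').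
Proof.
move=> [q qE] [q' qE']; exists (q * a' + b * q').
by rewrite mulrDr mulrA -qE mulrCA -qE'; ring.
Qed.

(** The unknowns enter [step] only under a factor [f z], so each application gains one order of
    agreement. *)
Lemma step_zcong n x y :
  (forall i, zcong n (x i) (y i)) -> forall i, zcong n.+1 (step x i) (step y i).
Proof.
move=> xy i; suff [q qE] : zcong n (\sum_(t <- T i) f t.1 * word_prod x t.2)
    (\sum_(t <- T i) f t.1 * word_prod y t.2).
  by exists q; rewrite /step opprD addrACA subrr add0r -mulrBr qE exprS mulrA.
elim: (T i) => [|[a s] r IHr]; first by rewrite !big_nil; apply: zcong_refl.
rewrite !big_cons; apply: zcong_add IHr; apply: zcong_mul (zcong_refl _ _) _ => /=.
elim: s => [|j s IHs]; first by rewrite /word_prod !big_nil; apply: zcong_refl.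
by rewrite /word_prod !big_cons; apply: zcong_mul.
Qed.

Hypothesis z_nilpotent : exists m, f z ^+ m = 0.

Lemma step_fixpoint : exists x, forall i, x i = step x i.
Proof.
(* The [m]-th iterate is fixed modulo [f z ^+ m], which is zero. *)
have [m zm] := z_nilpotent; exists (iter m step (fun=> 0)) => i.
have [] : zcong m (step (iter m step (fun=> 0)) i) (iter m step (fun=> 0) i).
  elim: m i {zm} => [|m IHm] i /=; last exact: step_zcong.
  by eexists; rewrite expr0 mul1r.
by move=> q /eqP; rewrite zm mul0r subr_eq0 => /eqP.
Qed.

Lemma step_fixpoint_unique x y :
  (forall i, x i = step x i) -> (forall i, y i = step y i) -> x =1 y.
Proof.
move=> xE yE i; have [m zm] := z_nilpotent.
have [] : zcong m (x i) (y i).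
  elim: m i {zm} => [|m IHm] i; last by rewrite xE yE; apply: step_zcong.
  by eexists; rewrite expr0 mul1r.
by move=> q /eqP; rewrite zm mul0r subr_eq0 => /eqP.
Qed.

End Contraction.

(** Exchanging the variables makes eps the main one, and the power of eps dividing [Q] is then the
    multiplicity of the root 0. *)
Lemma eps_factor (k : idomainType) (Q : {poly {poly k}}) : Q != 0 ->
  exists n Q1, Q = ('X%:P)^+ n * Q1 /\ map_poly (horner_eval 0) Q1 != 0.
Proof.
move=> Q0; have sQ0 : swapXY Q != 0 by rewrite swapXY_eq0.
have [n [S +] SE] := multiplicity_XsubC (swapXY Q) 0.
rewrite sQ0 /= => S0; exists n, (swapXY S); split.
  by rewrite -[LHS]swapXYK SE polyC0 subr0 rmorphM rmorphXn /= swapXY_X mulrC.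
by rewrite -horner_swapXY swapXYK polyC0 -rootE.
Qed.

Section Algebraic.
Variables (k : idomainType) (I : finType).
Variables (z : k) (c : I -> k) (T : I -> seq (k * seq I)).
Hypothesis T_quadratic : forall i t, t \in T i -> (size t.2 <= 2)%N.
Hypothesis z_neq0 : z != 0.

(* The system may be degenerate, so a perturbation by the cubic term
   z * eps * x_i^3 forces x to be integral over k[eps, 1/(z * eps)]; the relation
   so obtained is divided by the largest possible power of eps and specialised
   to eps = 0. *)
Let eps_system i : seq ({poly k} * seq I) :=
  ('X, [:: i; i; i]) :: [seq (t.1%:P, t.2) | t <- T i].
(** The perturbed equations solved for the term [z * eps * x_i ^+ 3], as [cubic_sol] requires. *)
Let eps_cubic i : seq ({poly k} * seq I) :=
  ((- c i)%:P, [::]) :: (1, [:: i]) :: [seq ((- (z * t.1))%:P, t.2) | t <- T i].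

Lemma eps_cubic_quadratic i t : t \in eps_cubic i -> (size t.2 <= 2)%N.
Proof.
rewrite !in_cons => /or3P[/eqP->|/eqP->|/mapP[s sT ->]] //.
exact: T_quadratic sT.
Qed.

Lemma step_fixpoint_algebraic (J : {pred I}) :
  exists2 W : {poly k}, W != 0 &
    forall (A : comNzRingType) (f : {rmorphism k -> A}) (x : I -> A),
    (exists m, f z ^+ m = 0) -> (forall i, x i = step f z c T x i) ->
    (map_poly f W).[ \sum_(i in J) x i] = 0.
Proof.
pose e : {poly k} := z%:P * 'X.
have [n [p [p_monic pE]]] := cubic_sol_integral e eps_cubic_quadratic J.
have e0 : e != 0 by rewrite mulf_neq0 ?polyX_eq0 ?polyC_eq0.
(* Since [p] annihilates [e ^+ n] times the linear form, [Q] annihilates the form itself. *)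
pose Q := p \Po (e ^+ n *: 'X).
have Q0 : Q != 0.
  rewrite comp_poly_eq0 ?monic_neq0 // size_scale ?expf_neq0 //.
  by rewrite size_polyX.
have [m [Q1 [QE Q10]]] := eps_factor Q0.
exists (map_poly (horner_eval 0) Q1) => // A f x z_nil xE.
pose F : {rmorphism {poly k} -> {poly A}} := map_poly f.
have FC a : F a%:P = (f a)%:P by rewrite /F /= map_polyC.
have FX : F 'X = 'X by rewrite /F /= map_polyX.
have [|X XE] := @step_fixpoint _ _ _ F z%:P (fun i => (c i)%:P) eps_system.
  by have [l zl] := z_nil; exists l; rewrite FC -rmorphXn zl.
have Xsol i : F e * X i ^+ 3 = \sum_(t <- eps_cubic i) F t.1 * word_prod X t.2.
  rewrite !big_cons big_map /= /word_prod big_nil big_seq1.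
  rewrite rmorph1 mul1r mulr1 rmorphM FX.
  have := XE i; rewrite /step big_cons big_map /= FX /word_prod !big_cons big_nil.
  under eq_bigr do rewrite FC.
  move=> Xi.
  have -> : \sum_(t <- T i) F (- (z * t.1))%:P * \prod_(j <- t.2) X j =
    - (F z%:P * \sum_(t <- T i) (f t.1)%:P * \prod_(j <- t.2) X j).
    rewrite mulr_sumr -sumrN; apply: eq_bigr => t _.
    by rewrite !FC rmorphN rmorphM polyCN polyCM mulNr mulrA.
  rewrite {2}Xi polyCN rmorphN; ring.
have := pE (CubicSol Xsol) => /=; set Y := \sum_(i in J) X i => pY.
have QY : (map_poly F Q).[Y] = 0.
  rewrite /Q map_comp_poly horner_comp map_polyZ map_polyX hornerZ hornerX.
  by rewrite rmorphXn.
have Q1Y : (map_poly F Q1).[Y] = 0.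
  move: QY; rewrite QE rmorphM rmorphXn /= map_polyC /= hornerM horner_exp hornerC FX.
  (* The power of eps is monic, hence can be cancelled over any [A]. *)
  by rewrite -[X in _ = X -> _](mulr0 'X^m) => /(monic_lreg (monicXn _ _)).
(* At eps = 0 the perturbed solution solves the original system; uniqueness identifies it with
   [x]. *)
have X0 : (fun i => (X i).[0]) =1 x.
  apply: (step_fixpoint_unique z_nil) => // i.
  rewrite {1}XE /step hornerD FC hornerC hornerM FC hornerC big_cons FX.
  rewrite hornerD hornerM hornerX mul0r add0r big_map; congr (_ + _ * _).
  rewrite -horner_evalE rmorph_sum /=; apply: eq_bigr => t _.
  by rewrite FC horner_evalE hornerM hornerC -horner_evalE rmorph_word_prod.
have Y0 : Y.[0] = \sum_(i in J) x i.
  rewrite -horner_evalE rmorph_sum /=; apply: eq_bigr => i _.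
  exact: X0.
rewrite -Y0 -map_poly_comp -[RHS](horner0 0) -Q1Y.
rewrite -[RHS]horner_evalE -horner_map /= -map_poly_comp horner_evalE.
congr (_.[_]); apply: eq_map_poly => a /=.
by rewrite !horner_evalE -horner_map rmorph0.
Qed.

End Algebraic.

(** * Green's function of a nearest neighbour walk on the tree *)


Section Tree.
Variables (r : nat) (B : pzRingType) (A0 : B) (A : letter r -> B).
Variable F : option (letter r) -> B.

(* F (Some x) is the generating function of the walks from 1 to x stopped at
   their first visit to x, and F None that of the walks from 1 to 1. *)
Hypothesis F_eq : forall o, F o = (if o is Some x then A x else 1) +
  (A0 * F o + \sum_(y | Some y != o) A y * F (Some (letter_inv y)) * F o).

Definition green_word (s : seq (letter r)) : B :=
  foldr (fun x b => F (Some x) * b) (F None) s.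

(** For [x :: s] this is the equation of [F (Some x)] multiplied on the right by [green_word s]: the
    step [x] cancels the first letter, and any other step [y] prepends [letter_inv y]. *)
Lemma green_wordE s : green_word s = (s == [::])%:R +
  (A0 * green_word s + \sum_y A y * green_word (word_cons (letter_inv y) s)).
Proof.
case: s => [|x s] /=.
  by rewrite {1}F_eq; do 2!congr (_ + _); apply: eq_bigr => y _; rewrite mulrA.
rewrite add0r {1}F_eq !mulrDl addrCA -mulrA; congr (_ + _).
rewrite [RHS](bigD1 x) //= letter_invK eqxx mulr_suml; congr (_ + _).
rewrite (eq_bigl (fun y => y != x)); last by move=> y; rewrite (inj_eq Some_inj).
apply: eq_bigr => y yx.
by rewrite letter_invK eq_sym (negPf yx) /= !mulrA.
Qed.

End Tree.

Section TreeSystem.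
Variables (k : comNzRingType) (r M : nat) (z : k).
Variables (A0 : 'M[k]_M) (A : letter r -> 'M[k]_M).

(** The unknown [(o, a, b)] is the entry [(a, b)] of the matrix [F o], which turns the matrix
    equations into a scalar system for [step]. *)
Definition tree_index : Type := (option (letter r) * 'I_M * 'I_M)%type.
HB.instance Definition _ := Finite.on tree_index.

Definition tree_const (i : tree_index) : k :=
  if i.1.1 is Some x then z * A x i.1.2 i.2 else (i.1.2 == i.2)%:R.

Definition tree_terms (i : tree_index) : seq (k * seq tree_index) :=
  [seq (A0 i.1.2 d, [:: (i.1.1, d, i.2)]) | d <- index_enum 'I_M] ++
  [seq (A t.1.1 i.1.2 t.1.2,
        [:: (Some (letter_inv t.1.1), t.1.2, t.2); (i.1.1, t.2, i.2)])
     | t <- index_enum (letter r * 'I_M * 'I_M)%type & Some t.1.1 != i.1.1].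

Lemma tree_terms_quadratic i t : t \in tree_terms i -> (size t.2 <= 2)%N.
Proof. by rewrite mem_cat => /orP[] /mapP[? _ ->]. Qed.

Variables (R : comNzRingType) (f : {rmorphism k -> R}) (x : tree_index -> R).
Hypothesis x_eq : forall i, x i = step f z tree_const tree_terms x i.

Definition tree_mx (o : option (letter r)) : 'M[R]_M := \matrix_(a, b) x (o, a, b).

Let zA y := f z *: map_mx f (A y).

Lemma tree_mxE o : tree_mx o = (if o is Some y then zA y else 1) +
  ((f z *: map_mx f A0) * tree_mx o +
   \sum_(y | Some y != o) zA y * tree_mx (Some (letter_inv y)) * tree_mx o).
Proof.
apply/matrixP => a b; rewrite !mxE x_eq /step /tree_const /=; congr (_ + _).
  by case: o => [y|]; rewrite !mxE ?rmorphM ?rmorph_nat.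
rewrite summxE /tree_terms big_cat !big_map big_filter.
rewrite mulrDr; congr (_ + _).
  rewrite mulr_sumr; apply: eq_bigr => d _.
  by rewrite !mxE /word_prod big_seq1 mulrA.
rewrite mulr_sumr.
under [RHS]eq_bigr => y _.
  rewrite mxE; under eq_bigr => d _.
    rewrite mxE mulr_suml; under eq_bigr => e _ do rewrite !mxE.
    over.
  rewrite exchange_big pair_bigA /=.
  over.
rewrite pair_big_dep /=.
rewrite (reindex (fun t : letter r * ('I_M * 'I_M) => (t.1, t.2.1, t.2.2))) /=; last first.
  by exists (fun t => (t.1.1, (t.1.2, t.2))) => [[? [? ?]]|[[? ?] ?]].
apply: eq_big => [t|t _]; first by rewrite andbT.
by rewrite /word_prod !big_cons big_nil mulr1 !mulrA.
Qed.

Lemma green_word_entry s a b :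
  green_word tree_mx s a b = ((s == [::]) && (a == b))%:R +
    (f z * \sum_d f (A0 a d) * green_word tree_mx s d b +
     \sum_y f z * \sum_d f (A y a d) *
       green_word tree_mx (word_cons (letter_inv y) s) d b).
Proof.
rewrite {1}(green_wordE tree_mxE s) !mxE summxE mulr_sumr; congr (_ + (_ + _)).
- by case: (s == _); rewrite !mxE.
- by apply: eq_bigr => d _; rewrite !mxE mulrA.
apply: eq_bigr => y _; rewrite mxE mulr_sumr.
by apply: eq_bigr => d _; rewrite !mxE mulrA.
Qed.

End TreeSystem.

(** * The action of the group ring on functions *)


Section GroupRingAction.
Variables (K : nzRingType) (G : groupType) (R : comNzRingType) (f : {rmorphism K -> R}).
Implicit Types (a b : group_ring K G) (h : G -> R).

(** The left regular action of the group ring, extended to functions of arbitrary support. *)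
Definition gr_act a h (g : G) : R := \sum_(w <- msupp a) f a@_w * h (w^-1 * g)%g.

Lemma gr_actw (d : {fset G}) a h g : (msupp a `<=` d)%fset ->
  gr_act a h g = \sum_(w <- d) f a@_w * h (w^-1 * g)%g.
Proof.
move=> ad; rewrite /gr_act; apply: big_fset_incl ad _ => w _ /mcoeff_outdom ->.
by rewrite rmorph0 mul0r.
Qed.

Lemma gr_actDl a b h g : gr_act (a + b) h g = gr_act a h g + gr_act b h g.
Proof.
rewrite (gr_actw _ _ (msuppD_le _ _)) (gr_actw h g (fsubsetUl (msupp a) (msupp b))).
rewrite (gr_actw h g (fsubsetUr (msupp a) (msupp b))) -big_split /=.
by apply: eq_bigr => w _; rewrite mcoeffD rmorphD mulrDl.
Qed.

Lemma gr_act_suml (I : Type) (s : seq I) (F : I -> group_ring K G) h g :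
  gr_act (\sum_(i <- s) F i) h g = \sum_(i <- s) gr_act (F i) h g.
Proof.
elim/big_ind2: _ => [|x a y b <- <-|//]; last by rewrite gr_actDl.
by rewrite /gr_act msupp0 big_seq_fset0.
Qed.

Lemma gr_actU c w h g : gr_act << c *g w >> h g = f c * h (w^-1 * g)%g.
Proof. by rewrite (gr_actw _ _ msuppU_le) big_seq_fset1 mcoeffUU. Qed.

Lemma gr_actM a b h g : gr_act (a * b) h g = gr_act a (gr_act b h) g.
Proof.
rewrite [a * b]/(gr_mul a b) /gr_mul gr_act_suml; apply: eq_bigr => u _.
rewrite gr_act_suml /gr_act mulr_sumr; apply: eq_bigr => w _.
by rewrite -/(gr_act _ _ _) gr_actU rmorphM invgM mulrA !mulgA.
Qed.

Lemma gr_act1 h g : gr_act 1 h g = h g.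
Proof. by rewrite [1]/(gr_one K G) gr_actU rmorph1 mul1r invg1 mul1g. Qed.

Lemma gr_actDr a h h' g : gr_act a (fun u => h u + h' u) g = gr_act a h g + gr_act a h' g.
Proof. by rewrite -big_split; apply: eq_bigr => w _; rewrite mulrDr. Qed.

Lemma gr_actZr a c h g : gr_act a (fun u => c * h u) g = c * gr_act a h g.
Proof. by rewrite mulr_sumr; apply: eq_bigr => w _; rewrite mulrCA. Qed.

Lemma gr_act_sumr (I : Type) (s : seq I) (F : I -> G -> R) a g :
  gr_act a (fun u => \sum_(i <- s) F i u) g = \sum_(i <- s) gr_act a (F i) g.
Proof. by rewrite exchange_big; apply: eq_bigr => w _; rewrite mulr_sumr. Qed.

Lemma eq_gr_act a h h' g : h =1 h' -> gr_act a h g = gr_act a h' g.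
Proof. by move=> hh'; apply: eq_bigr => w _; rewrite hh'. Qed.

Variable N : nat.
Implicit Types (P Q : 'M[group_ring K G]_N) (H : 'I_N -> G -> R).

Definition mx_act P H i g : R := \sum_j gr_act (P i j) (H j) g.

Lemma eq_mx_act P H H' i g : (forall j u, H j u = H' j u) -> mx_act P H i g = mx_act P H' i g.
Proof. by move=> HH'; apply: eq_bigr => j _; apply: eq_gr_act. Qed.

Lemma mx_actM P Q H i g : mx_act (P * Q) H i g = mx_act P (mx_act Q H) i g.
Proof.
rewrite /mx_act; under eq_bigr do rewrite mxE gr_act_suml.
rewrite exchange_big; apply: eq_bigr => j _ /=.
by under eq_bigr do rewrite gr_actM; rewrite -gr_act_sumr.
Qed.

Lemma mx_act1 H i g : mx_act 1 H i g = H i g.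
Proof.
rewrite /mx_act (bigD1 i) //= mxE eqxx gr_act1 big1 ?addr0 // => j ji.
by rewrite mxE eq_sym (negPf ji) /gr_act msupp0 big_seq_fset0.
Qed.

Lemma mx_actDr P H H' i g :
  mx_act P (fun j u => H j u + H' j u) i g = mx_act P H i g + mx_act P H' i g.
Proof. by rewrite -big_split; apply: eq_bigr => j _; rewrite gr_actDr. Qed.

Lemma mx_actZr P c H i g : mx_act P (fun j u => c * H j u) i g = c * mx_act P H i g.
Proof. by rewrite mulr_sumr; apply: eq_bigr => j _; rewrite gr_actZr. Qed.

Definition gr_delta (j i : 'I_N) (g : G) : R := ((i == j) && (g == 1%g))%:R.

Lemma mx_act_delta P j i : mx_act P (gr_delta j) i 1%g = f (gr_trace (P i j)).
Proof.
rewrite /mx_act (bigD1 j) //= big1 ?addr0; last first.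
  move=> l lj; rewrite /gr_act big1 // => w _.
  by rewrite /gr_delta (negPf lj) mulr0.
rewrite (gr_actw _ _ (fsubsetUr [fset (1%g : G)]%fset _)) (big_fsetD1 1%g) /=; last first.
  by rewrite !inE eqxx.
rewrite invg1 mulg1 /gr_delta !eqxx mulr1 big_seq big1 ?addr0 // => w.
rewrite !inE mulg1 => /andP[w1 _].
by rewrite -(inj_eq invg_inj) invgK invg1 (negPf w1) mulr0.
Qed.

(** A truncated Neumann series: substituting the equation into itself [m] times leaves a remainder
    with the factor [z ^+ m]. *)
Lemma mx_act_resolvent P z H j :
  (forall i g, H i g = gr_delta j i g + z * mx_act P H i g) ->
  forall m, z ^+ m = 0 -> H j 1%g = \sum_(n < m) z ^+ n * f (gr_trace ((P ^+ n) j j)).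
Proof.
move=> HE m zm.
suff -> : H j 1%g = \sum_(n < m) z ^+ n * mx_act (P ^+ n) (gr_delta j) j 1%g
    + z ^+ m * mx_act (P ^+ m) H j 1%g.
  by rewrite zm mul0r addr0; apply: eq_bigr => n _; rewrite mx_act_delta.
elim: m {zm} => [|m IHm]; first by rewrite big_ord0 add0r !expr0 mul1r mx_act1.
rewrite IHm big_ord_recr /= -addrA; congr (_ + _).
rewrite (eq_mx_act _ _ _ HE) mx_actDr mulrDr mx_actZr mulrA -exprSr; congr (_ + _ * _).
by rewrite exprSr mx_actM.
Qed.

End GroupRingAction.

(** * Reduction to nearest neighbour walks *)


Section Linearization.
Variables (r N L : nat) (P : 'M[group_ring rat (free_group r)]_N).
Hypothesis P_size : forall i j w, w \in msupp (P i j) -> (size (word_of w) <= L.+1)%N.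

(** Being 0 on words that are not reduced, it allows sums over all words of bounded length. *)
Definition word_coef i j (s : seq (letter r)) : rat :=
  \sum_(w <- msupp (P i j) | word_of w == s) (P i j)@_w.

Definition lin_state : Type := (L.-bseq (letter r) * 'I_N)%type.
HB.instance Definition _ := Finite.on lin_state.

(* A state (u, i) stands for the function g |-> z^|u| * h_i (u^-1 g), where h
   solves h = delta + z^(L+1) P h. In terms of these functions the equation only
   involves the translations of g by single letters. *)
Definition lin_stay : 'M[{poly rat}]_#|{: lin_state}| := \matrix_(a, b)
  let: (u, i) := enum_val a : lin_state in let: (v, j) := enum_val b : lin_state in
  if (val u == [::]) && (val v == [::]) then 'X^L * (word_coef i j [::])%:P else 0.

(** From an empty word, [y] is crossed at once and [v] is left pending; a pending word [y :: v] then
    crosses [y]. The weight ['X^(L - size v)], the factor ['X] of this step and those of the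
    [size v] later steps multiply to ['X^(L.+1)]. *)
Definition lin_move (y : letter r) : 'M[{poly rat}]_#|{: lin_state}| := \matrix_(a, b)
  let: (u, i) := enum_val a : lin_state in let: (v, j) := enum_val b : lin_state in
  if val u == [::] then 'X^(L - size v) * (word_coef i j (y :: v))%:P
  else ((val u == y :: v) && (i == j))%:R.

Variables (R : comNzRingType) (f : {rmorphism {poly rat} -> R}).

Lemma word_coef_sum (phi : seq (letter r) -> R) i j :
  f (word_coef i j [::])%:P * phi [::] +
  \sum_y \sum_(v : L.-bseq (letter r)) f (word_coef i j (y :: v))%:P * phi (y :: v) =
  \sum_(w <- msupp (P i j)) f ((P i j)@_w)%:P * phi (word_of w).
Proof.
have coefE s : f (word_coef i j s)%:P * phi s = \sum_(w <- msupp (P i j))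
    if word_of w == s then f ((P i j)@_w)%:P * phi (word_of w) else 0.
  rewrite -big_mkcond -[f _]/((f \o polyC) _) rmorph_sum /= mulr_suml.
  by apply: eq_bigr => w /eqP ->.
rewrite coefE; under [X in _ + X]eq_bigr do (under eq_bigr do rewrite coefE; rewrite exchange_big /=).
rewrite [X in _ + X]exchange_big -big_split /=; apply: eq_big_seq => w wP.
set t := _ * phi _; case wE : (word_of w) => [|y v] /=.
  by rewrite big1 ?addr0 // => y _; rewrite big1.
have vL : (size v <= L)%N by have := P_size wP; rewrite wE.
rewrite add0r (bigD1 y) //= (bigD1 (Bseq vL)) //= eqxx !big1 ?addr0 // => [y'|v'] ne.
  by rewrite big1 // => v' _; case: eqP => // -[yE]; case/eqP: ne.
by case: eqP => // -[vE]; case/eqP: ne; apply/val_inj.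
Qed.

Local Notation M := #|{: lin_state}|.
Local Notation z := (f 'X).

Variable x : tree_index r M -> R.
Hypothesis x_eq : forall i,
  x i = step f 'X (tree_const 'X lin_move) (tree_terms lin_stay lin_move) x i.

Definition nil_state (i : 'I_N) : 'I_M := enum_rank (([bseq], i) : lin_state).

Section Column.
Variable j0 : 'I_N.

Let H (p : lin_state) (s : seq (letter r)) : R :=
  green_word (tree_mx x) s (enum_rank p) (nil_state j0).

Let sum_state (F : 'I_M -> R) : \sum_d F d = \sum_v \sum_j F (enum_rank ((v, j) : lin_state)).
Proof.
rewrite pair_bigA /= (reindex (@enum_rank lin_state)) /=; last first.
  by exists enum_val => d _; rewrite ?enum_valK ?enum_rankK.
by apply: eq_bigr => -[].
Qed.

Lemma lin_unroll1 y (v : L.-bseq (letter r)) (u : L.-bseq (letter r)) i s :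
  val u = y :: val v -> H (u, i) s = z * H (v, i) (word_cons (letter_inv y) s).
Proof.
move=> uE; rewrite /H {1}(green_word_entry x_eq) (inj_eq enum_rank_inj).
have -> : ((u, i) == ([bseq], j0) :> lin_state) = false.
  by apply/negP => /eqP[/(congr1 val)]; rewrite uE.
rewrite andbF add0r big1 ?mulr0 ?add0r; last first.
  by move=> d _; rewrite mxE enum_rankK uE; case: (enum_val d) => ? ? /=; rewrite rmorph0 mul0r.
rewrite (bigD1 y) //= [X in _ + X]big1 ?addr0; last first.
  move=> y' y'y; rewrite big1 ?mulr0 // => d _; rewrite mxE enum_rankK uE.
  by case: (enum_val d) => v' j' /=; rewrite eqseq_cons eq_sym (negPf y'y) /= rmorph0 mul0r.
congr (_ * _); rewrite (bigD1 (enum_rank ((v, i) : lin_state))) //= big1 ?addr0.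
  by rewrite mxE !enum_rankK uE /= !eqxx rmorph1 mul1r.
move=> d dE; rewrite mxE enum_rankK uE.
case dvE : (enum_val d) => [v' j'] /=; case: eqP => [[vE]|_]; last by rewrite rmorph0 mul0r.
case: eqP => [iE|_]; last by rewrite rmorph0 mul0r.
case/eqP: dE; apply: enum_val_inj; rewrite dvE enum_rankK iE.
by congr pair; apply/val_inj.
Qed.

(** This confirms the meaning given to the states: pending letters are crossed one by one, each
    costing a factor [z]. *)
Lemma lin_unroll (u : L.-bseq (letter r)) i s :
  H (u, i) s = z ^+ size u * H ([bseq], i) (word_mul (word_inv u) s).
Proof.
case: u => u uL /=; elim: u uL s => [|y u IHu] uL s /=.
  by rewrite expr0 mul1r; congr (H (_, _) _); apply: val_inj.
rewrite (@lin_unroll1 y (Bseq (ltnW uL)) (Bseq uL) i s erefl) IHu mulrA -exprS.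
by rewrite /word_inv map_cons rev_cons -cats1 /word_mul foldr_cat.
Qed.

(** Eliminating the states with a nonempty word recovers the resolvent equation of [P] with
    parameter [z ^+ L.+1]. *)
Lemma lin_resolvent i s : H ([bseq], i) s = ((i == j0) && (s == [::]))%:R +
  z ^+ L.+1 * \sum_j \sum_(w <- msupp (P i j))
    f ((P i j)@_w)%:P * H ([bseq], j) (word_mul (word_inv (word_of w)) s).
Proof.
rewrite {1}/H {1}(green_word_entry x_eq) (inj_eq enum_rank_inj).
rewrite xpair_eqE eqxx /= andbC; congr (_ + _).
have -> : \sum_d f (lin_stay (enum_rank ([bseq], i)) d) *
      green_word (tree_mx x) s d (nil_state j0) =
    \sum_j f ('X^L * (word_coef i j [::])%:P) * H ([bseq], j) s.
  rewrite sum_state (bigD1 ([bseq] : L.-bseq _)) //= [X in _ + X]big1 ?addr0.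
    by apply: eq_bigr => j _; rewrite mxE !enum_rankK.
  move=> v vn; apply: big1 => j _; rewrite mxE !enum_rankK /=.
  by case: eqP => [vE|_]; [case/eqP: vn; apply: val_inj|rewrite rmorph0 mul0r].
pose phi j u := H ([bseq], j) (word_mul (word_inv u) s).
under [X in _ = _ * X]eq_bigr => j _ do rewrite -(word_coef_sum (phi j)).
rewrite big_split /= -mulr_sumr -mulrDr exprS -[RHS]mulrA [X in _ = _ * X]mulrDr; congr (_ * (_ + _)).
  by rewrite mulr_sumr; apply: eq_bigr => j _; rewrite rmorphM rmorphXn mulrA.
rewrite [X in _ = _ * X]exchange_big mulr_sumr; apply: eq_bigr => y _ /=.
rewrite sum_state exchange_big mulr_sumr; apply: eq_bigr => j _ /=.
rewrite mulr_sumr; apply: eq_bigr => v _.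
rewrite mxE !enum_rankK /= -/(H (v, j) _) lin_unroll /phi.
have -> : word_mul (word_inv (y :: v)) s = word_mul (word_inv v) (word_cons (letter_inv y) s).
  by rewrite /word_inv map_cons rev_cons -cats1 /word_mul foldr_cat.
have LE : L = (L - size v + size v)%N by rewrite subnK ?size_bseq.
by rewrite rmorphM rmorphXn [X in _ = _ ^+ X * _]LE exprD; ring.
Qed.

Lemma lin_green m : z ^+ (L.+1 * m) = 0 ->
  x (None, nil_state j0, nil_state j0) =
  \sum_(n < m) z ^+ (L.+1 * n) * f (gr_trace ((P ^+ n) j0 j0))%:P.
Proof.
move=> zm.
pose h i (g : free_group r) := H ([bseq], i) (word_of g).
have hE i g : h i g = gr_delta R j0 i g + z ^+ L.+1 * mx_act (f \o polyC) P h i g.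
  exact: lin_resolvent.
transitivity (h j0 1%g); first by rewrite /h /H /= mxE.
rewrite (mx_act_resolvent hE (m := m)); last by rewrite -exprM.
by apply: eq_bigr => n _; rewrite exprM.
Qed.

End Column.

End Linearization.

(** * The formal trace series *)


Section ResiduePoly.
Variables (K : comNzRingType) (d j : nat).
Hypothesis jd : (j < d)%N.

(* Turns a relation satisfied by a series in z^d into one satisfied by the same
   series in z. *)
Definition residue_poly (S : {poly K}) : {poly K} := \poly_(i < size S) S`_(d * i + j).

Lemma coef_residue_poly S i : (residue_poly S)`_i = S`_(d * i + j).
Proof.
have d0 : (0 < d)%N by case: d jd.
rewrite coef_poly; case: ltnP => // Si; rewrite nth_default //.
by rewrite (leq_trans Si) // (leq_trans (leq_pmull i d0)) ?leq_addr.
Qed.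

Lemma residue_poly0 : residue_poly 0 = 0.
Proof. by apply/polyP => i; rewrite coef_residue_poly !coef0. Qed.

Lemma residue_poly_sum I (r : seq I) (F : I -> {poly K}) :
  residue_poly (\sum_(i <- r) F i) = \sum_(i <- r) residue_poly (F i).
Proof.
apply/polyP => i; rewrite coef_residue_poly !coef_sum.
by apply: eq_bigr => l _; rewrite coef_residue_poly.
Qed.

(** Selecting the exponents congruent to [j] modulo [d] is linear over the polynomials in ['X^d]. *)
Lemma residue_poly_compXn T S :
  residue_poly ((T \Po 'X^d) * S) = T * residue_poly S.
Proof.
rewrite comp_polyE mulr_suml residue_poly_sum -[X in _ = X * _]coefK poly_def mulr_suml.
apply: eq_bigr => l _; apply/polyP => i.
rewrite coef_residue_poly -!scalerAl !coefZ -exprM !coefXnM coef_residue_poly.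
have -> : (d * i + j < d * l)%N = (i < l)%N by apply/idP/idP; nia.
by case: ltnP => // li; congr (_ * _`_ _); nia.
Qed.

Lemma horner_residue_poly (W : {poly {poly K}}) (p : {poly K}) :
  (map_poly residue_poly W).[p] = residue_poly W.[p \Po 'X^d].
Proof.
rewrite [in RHS]horner_coef residue_poly_sum (horner_coef_wide p (size_poly _ _)).
apply: eq_bigr => i _; rewrite coef_map_id0 ?residue_poly0 //.
by rewrite mulrC -rmorphXn /= [in RHS]mulrC residue_poly_compXn.
Qed.

End ResiduePoly.

Lemma residue_poly_neq0 (K : comNzRingType) d (W : {poly {poly K}}) :
  (0 < d)%N -> W != 0 -> exists2 j, (j < d)%N & map_poly (residue_poly d j) W != 0.
Proof.
(* The top term of the leading coefficient has degree [n] and survives in the residue class of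
   [n]. *)
move=> d0 W0; pose n := (size (lead_coef W)).-1.
have jd : (n %% d < d)%N by rewrite ltn_mod.
exists (n %% d)%N => //; apply/negP => /eqP Wj.
have : lead_coef (lead_coef W) != 0 by rewrite !lead_coef_eq0.
have := congr1 (fun p : {poly {poly K}} => p`_(size W).-1`_(n %/ d)) Wj.
rewrite /= coef_map_id0 ?residue_poly0 // coef_residue_poly // !coef0.
by rewrite mulnC -divn_eq /lead_coef => ->; rewrite eqxx.
Qed.

Lemma in_qpolyXn_eq0 (K : comNzRingType) n (p : {poly K}) :
  (0 < n)%N -> in_qpoly 'X^n p = 0 -> exists S, p = 'X^n * S.
Proof.
case: n => // n _ /(congr1 val) /=.
rewrite /mk_monic size_polyXn monicXn /= => p0.
exists (Pdiv.Ring.rdivp p 'X^(n.+1)).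
by have := Pdiv.RingMonic.rdivp_eq (monicXn _ n.+1) p; rewrite p0 addr0 mulrC.
Qed.

Lemma trace_series_algebraic (r N : nat) (P : 'M[group_ring rat (free_group r)]_N) :
  exists2 Q : {poly {poly rat}}, Q != 0 &
    forall m, exists S, Q.[ \poly_(n < m) trace_coef P n] = 'X^m * S.
Proof.
pose L := (\max_i \max_j \max_(w <- msupp (P i j)) size (word_of w))%N.
have P_size i j w : w \in msupp (P i j) -> (size (word_of w) <= L.+1)%N.
  move=> wP; apply: leqW; apply: leq_trans (leq_bigmax i).
  apply: leq_trans (leq_bigmax j).
  by rewrite (big_rem w wP) leq_maxl.
pose st := nil_state r L (N := N).
(* [W] is fixed before any truncation, so it serves every [m]. The index set selects the diagonal
   entries of the Green matrix at the identity whose sum is the trace series in ['X^(L.+1)]. *)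
have [W W0 WE] := step_fixpoint_algebraic
  (tree_const 'X (@lin_move _ _ L P))
  (@tree_terms_quadratic _ r _ (lin_stay L P) (@lin_move _ _ L P))
  (negbT (polyX_eq0 _))
  (mem [set (None, st j, st j) | j : 'I_N]).
have [j jL Wj0] := residue_poly_neq0 (ltn0Sn L) W0.
exists (map_poly (residue_poly L.+1 j) W) => // -[|m].
  by eexists; rewrite expr0 mul1r.
(* Precision [m.+1] for a series in ['X^(L.+1)]. *)
pose n := (L.+1 * m.+1)%N.
have : exists f : {rmorphism {poly rat} -> {poly %/ ('X^n : {poly rat})}},
    f 'X ^+ n = 0 /\ (forall p, f p = 0 -> exists S, p = 'X^n * S).
  exists (in_qpoly 'X^n : {rmorphism {poly rat} -> {poly %/ 'X^n}}).
  split=> [|p]; last exact: in_qpolyXn_eq0.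
  rewrite -rmorphXn /=; apply: val_inj => /=.
  by rewrite /mk_monic size_polyXn monicXn; apply: Pdiv.RingMonic.rmodpp; apply: monicXn.
case=> f [fX f0].
have fX_nil : exists l, f 'X ^+ l = 0 by exists n.
have [x xE] := step_fixpoint (tree_const 'X (@lin_move _ _ L P))
  (tree_terms (lin_stay L P) (@lin_move _ _ L P)) fX_nil.
have xsum : \sum_(i in mem [set (None, st j, st j) | j : 'I_N]) x i =
    f ((\poly_(n < m.+1) trace_coef P n) \Po 'X^(L.+1)).
  rewrite big_imset /=; last by move=> a b _ _ [/enum_rank_inj[]].
  under eq_bigr do rewrite (lin_green P_size xE _ fX).
  rewrite exchange_big poly_def linear_sum rmorph_sum /=; apply: eq_bigr => l _.
  rewrite -mulr_sumr linearZ /= -mul_polyC comp_Xn_poly rmorphM -exprM rmorphXn mulrC.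
  by rewrite /trace_coef /mx_gr_trace 2!rmorph_sum.
have := WE _ f x fX_nil xE; rewrite xsum horner_map => /f0[S SE].
exists (residue_poly L.+1 j S).
by rewrite horner_residue_poly // SE -residue_poly_compXn // comp_Xn_poly -exprM.
Qed.

(** * Weighted norms of polynomials *)


Section WeightedNorm.
Variables (K : numDomainType) (rho : K).
Hypothesis rho_ge0 : 0 <= rho.
Implicit Types p q : {poly K}.

Definition poly_norm p : K := (map_poly (fun a => `|a|) p).[rho].

Lemma poly_norm_wide n p : (size p <= n)%N -> poly_norm p = \sum_(i < n) `|p`_i| * rho ^+ i.
Proof.
move=> pn; rewrite /poly_norm (horner_coef_wide _ (leq_trans (size_poly _ _) pn)).
by apply: eq_bigr => i _; rewrite coef_map_id0 ?normr0.
Qed.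

Lemma poly_norm_ge0 p : 0 <= poly_norm p.
Proof.
rewrite (poly_norm_wide (leqnn _)); apply: sumr_ge0 => i _.
by rewrite mulr_ge0 ?exprn_ge0.
Qed.

Lemma poly_normD p q : poly_norm (p + q) <= poly_norm p + poly_norm q.
Proof.
have pM := leq_maxl (size p) (size q); have qM := leq_maxr (size p) (size q).
rewrite (poly_norm_wide (leq_trans (size_polyD p q) (leqnn _))).
rewrite (poly_norm_wide pM) (poly_norm_wide qM) -big_split /=; apply: ler_sum => i _.
by rewrite coefD -mulrDl ler_wpM2r ?exprn_ge0 ?ler_normD.
Qed.

Lemma poly_norm0 : poly_norm 0 = 0.
Proof. by rewrite /poly_norm map_poly0 horner0. Qed.

Lemma poly_normC c : poly_norm c%:P = `|c|.
Proof. by rewrite (poly_norm_wide (size_polyC_leq1 c)) big_ord1 coefC mulr1. Qed.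

Lemma poly_normMX p : poly_norm (p * 'X) = poly_norm p * rho.
Proof.
rewrite /poly_norm; suff -> : map_poly (fun a => `|a|) (p * 'X) =
  map_poly (fun a => `|a|) p * 'X by rewrite hornerMX.
apply/polyP => i; rewrite coefMX !coef_map_id0 ?normr0 // coefMX.
by case: i => [|i] /=; rewrite ?normr0.
Qed.

Lemma poly_normMXn p n : poly_norm (p * 'X^n) = poly_norm p * rho ^+ n.
Proof.
elim: n => [|n IHn]; first by rewrite !expr0 !mulr1.
by rewrite !exprSr !mulrA poly_normMX IHn.
Qed.

Lemma poly_norm_scale c p : poly_norm (c *: p) = `|c| * poly_norm p.
Proof.
rewrite (poly_norm_wide (size_scale_leq c p)) (poly_norm_wide (leqnn _)) mulr_sumr.
by apply: eq_bigr => i _; rewrite coefZ normrM mulrA.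
Qed.

Lemma poly_normM p q : poly_norm (p * q) <= poly_norm p * poly_norm q.
Proof.
elim/poly_ind: p => [|p c IHp]; first by rewrite mul0r poly_norm0 mul0r.
have -> : poly_norm (p * 'X + c%:P) = poly_norm p * rho + `|c|.
  rewrite /poly_norm; suff -> : map_poly (fun a => `|a|) (p * 'X + c%:P) =
    map_poly (fun a => `|a|) p * 'X + `|c|%:P by rewrite hornerMXaddC.
  apply/polyP => i; rewrite coefD coefMX coefC !coef_map_id0 ?normr0 //.
  by rewrite coefD coefMX coefC; case: i => [|i] /=; rewrite ?add0r ?addr0.
rewrite mulrDl mulrAC mul_polyC; apply: le_trans (poly_normD _ _) _.
rewrite poly_normMX poly_norm_scale mulrDl lerD2r [leRHS]mulrAC.
by rewrite ler_wpM2r.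
Qed.

Lemma poly_normX p n : poly_norm (p ^+ n) <= poly_norm p ^+ n.
Proof.
elim: n => [|n IHn]; first by rewrite !expr0 -polyC1 poly_normC normr1.
rewrite !exprS; apply: le_trans (poly_normM _ _) _.
by rewrite ler_wpM2l ?poly_norm_ge0.
Qed.

Lemma poly_norm_sum I (r : seq I) (F : I -> {poly K}) :
  poly_norm (\sum_(i <- r) F i) <= \sum_(i <- r) poly_norm (F i).
Proof.
elim/big_rec2: _ => [|i b p _ pb]; first by rewrite poly_norm0.
by apply: le_trans (poly_normD _ _) _; rewrite lerD2l.
Qed.

(** The bound depends on [p] only through [B], hence is uniform over the truncations of the trace
    series. *)
Lemma poly_norm_horner (Q : {poly {poly K}}) p B : poly_norm p <= B ->
  poly_norm Q.[p] <= \sum_(i < size Q) poly_norm Q`_i * B ^+ i.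
Proof.
move=> pB; rewrite horner_coef; apply: le_trans (poly_norm_sum _ _) _.
apply: ler_sum => i _; apply: le_trans (poly_normM _ _) _.
rewrite ler_wpM2l ?poly_norm_ge0 // (le_trans (poly_normX _ _)) //.
by rewrite lerXn2r // nnegrE ?poly_norm_ge0 // (le_trans (poly_norm_ge0 _) pB).
Qed.

End WeightedNorm.

Lemma poly_norm_ratr (F : numFieldType) (rho : rat) (p : {poly rat}) (z : F) :
  `|z| <= ratr rho -> `|(map_poly ratr p).[z]| <= ratr (poly_norm rho p).
Proof.
move=> zrho; rewrite (poly_norm_wide _ (leqnn _)) horner_coef size_map_poly.
rewrite rmorph_sum /=; apply: le_trans (ler_norm_sum _ _ _) _.
apply: ler_sum => i _; rewrite coef_map /= normrM rmorphM /= -ratr_norm normrX rmorphXn /=.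
by rewrite ler_wpM2l ?ler0q // lerXn2r // nnegrE ?normr_ge0 // (le_trans _ zrho).
Qed.

(** As in the Schwarz lemma, halving the radius turns the factor ['X^m] into a gain of
    [2^-1 ^+ m]. *)
Lemma poly_norm_ratr_Xn (F : numFieldType) (rho : rat) m (p S : {poly rat}) (z : F) :
  0 < rho -> p = 'X^m * S -> `|z| <= ratr (rho / 2) ->
  `|(map_poly ratr p).[z]| <= ratr (2^-1 ^+ m * poly_norm rho p).
Proof.
move=> rho0 -> zrho.
have zrho' : `|z| <= ratr rho.
  by rewrite (le_trans zrho) // ler_rat ler_pdivrMr // mulr_natr mulr2n lerDl ltW.
have -> : 2^-1 ^+ m * poly_norm rho ('X^m * S) = (rho / 2) ^+ m * poly_norm rho S.
  by rewrite mulrC ['X^m * S]mulrC poly_normMXn exprMn -mulrA mulrC.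
rewrite !rmorphM rmorphXn /= map_polyXn hornerM hornerXn normrM normrX.
apply: ler_pM; rewrite ?normr_ge0 ?exprn_ge0 //; last exact: poly_norm_ratr.
by rewrite lerXn2r ?nnegrE ?normr_ge0 // (le_trans _ zrho).
Qed.

(** * Exponential growth of the trace coefficients *)

Section TraceBound.
Variables (G : groupType) (N : nat) (P : 'M[group_ring rat G]_N).

(** It bounds the operator norm of [P] on bounded functions. *)
Definition mx_gr_norm : rat := \sum_i \sum_j \sum_(w <- msupp (P i j)) `|(P i j)@_w|.

Lemma mx_gr_norm_ge0 : 0 <= mx_gr_norm.
Proof. by do 2!(apply: sumr_ge0 => ? _); apply: sumr_ge0. Qed.

Lemma mx_act_bound (H : 'I_N -> G -> rat) B : 0 <= B ->
  (forall i g, `|H i g| <= B) -> forall i g, `|mx_act idfun P H i g| <= mx_gr_norm * B.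
Proof.
move=> B0 HB i g.
apply: (@le_trans _ _ ((\sum_j \sum_(w <- msupp (P i j)) `|(P i j)@_w|) * B)).
  rewrite mulr_suml; apply: le_trans (ler_norm_sum _ _ _) _; apply: ler_sum => j _.
  rewrite mulr_suml; apply: le_trans (ler_norm_sum _ _ _) _; apply: ler_sum => w _.
  by rewrite normrM ler_wpM2l.
rewrite ler_wpM2r // /mx_gr_norm [leRHS](bigD1 i) //= lerDl.
by do 2!(apply: sumr_ge0 => ? _); apply: sumr_ge0.
Qed.

Lemma trace_coef_bound n : `|trace_coef P n| <= N%:R * mx_gr_norm ^+ n.
Proof.
rewrite /trace_coef /mx_gr_trace; apply: le_trans (ler_norm_sum _ _ _) _.
apply: (@le_trans _ _ (\sum_(j < N) mx_gr_norm ^+ n)); last first.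
  by rewrite sumr_const card_ord mulr_natl.
apply: ler_sum => j _.
rewrite -[gr_trace _]/(idfun _) -mx_act_delta.
(* The induction needs the bound at every row and group element; the column [j] stays fixed. *)
move: {2}j (1%g : G); elim: n => [|n IHn] i g.
  by rewrite !expr0 mx_act1 /gr_delta; case: (_ && _); rewrite ?normr1 ?normr0.
rewrite !exprS mx_actM; apply: mx_act_bound => //.
by rewrite exprn_ge0 ?mx_gr_norm_ge0.
Qed.

Lemma trace_coef_radius : exists2 rho : rat, 0 < rho &
  forall n, `|trace_coef P n| * rho ^+ n <= N%:R * 2^-1 ^+ n.
Proof.
(* Adding 1 keeps [K] positive when [P] is zero; the factor 2 in the radius yields geometric
   decay. *)
pose K := mx_gr_norm + 1; have K0 : 0 < K by rewrite ltr_wpDl ?mx_gr_norm_ge0.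
exists (2 * K)^-1 => [|n]; first by rewrite invr_gt0 mulr_gt0.
apply: (@le_trans _ _ (N%:R * K ^+ n * (2 * K)^-1 ^+ n)).
  apply: ler_wpM2r; first by rewrite exprn_ge0 // invr_ge0 mulr_ge0 // ltW.
  apply: le_trans (trace_coef_bound n) _; rewrite ler_wpM2l // lerXn2r ?nnegrE ?mx_gr_norm_ge0 //.
    exact: ltW.
  by rewrite lerDl.
by rewrite -mulrA -exprMn invfM mulrCA divff ?mulr1 // gt_eqF.
Qed.

End TraceBound.

Lemma geometric_half_sum (n : nat) : \sum_(i < n) (2^-1 : rat) ^+ i <= 2.
Proof.
suff -> : \sum_(i < n) (2^-1 : rat) ^+ i = 2 - 2 * 2^-1 ^+ n.
  by rewrite lerBlDr lerDl mulr_ge0 // exprn_ge0.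
elim: n => [|n IHn]; first by rewrite big_ord0 expr0 mulr1 subrr.
by rewrite big_ord_recr /= IHn exprS; lra.
Qed.

Lemma trace_poly_norm (G : groupType) N (P : 'M[group_ring rat G]_N) (rho : rat) m :
  (forall n, `|trace_coef P n| * rho ^+ n <= N%:R * 2^-1 ^+ n) ->
  poly_norm rho (\poly_(n < m) trace_coef P n) <= N%:R * 2.
Proof.
move=> Prho; rewrite (poly_norm_wide _ (size_poly _ _)).
apply: le_trans (_ : N%:R * \sum_(n < m) 2^-1 ^+ n <= _); last first.
  by rewrite ler_wpM2l ?geometric_half_sum.
by rewrite mulr_sumr; apply: ler_sum => n _; rewrite coef_poly ltn_ord.
Qed.

Local Open Scope classical_set_scope.
Local Open Scope ring_scope.

(** * Convergence in the complex plane *)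


Lemma cvg_horner (K : numFieldType) (p : {poly K}) (u : nat -> K^o) (l : K^o) :
  u n @[n --> \oo] --> l -> (p.[u n] : K^o) @[n --> \oo] --> (p.[l] : K^o).
Proof.
move=> ul; elim/poly_ind: p => [|p c IHp].
  by rewrite horner0; under eq_fun do rewrite horner0; apply: cvg_cst.
rewrite hornerMXaddC; under eq_fun do rewrite hornerMXaddC.
apply: cvgD; last exact: cvg_cst.
exact: cvgM IHp ul.
Qed.

Section ComplexCvg.
Variable R : realType.
Implicit Types (u : nat -> R[i]^o) (x : R[i]).

Lemma normc_i : `|'i%C : R[i]| = 1.
Proof. by rewrite normc_def /= expr0n add0r expr1n sqrtr1. Qed.

Lemma normc_ge_Im x : (`|complex.Im x|%:C)%C <= `|x|.
Proof.
by have := normc_ge_Re (x * 'i%C); rewrite ReiNIm normrN normrM normc_i mulr1.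
Qed.

Lemma normc_le_ReIm x : `|x| <= ((`|complex.Re x| + `|complex.Im x|)%:C)%C.
Proof.
rewrite {1}[x]complexE (le_trans (ler_normD _ _)) // rmorphD /= normrM normc_i mul1r.
by rewrite !normc_def /= !expr0n /= !addr0 !sqrtr_sqr.
Qed.

Lemma complexReD x y : complex.Re (x + y) = complex.Re x + complex.Re y.
Proof. by case: x; case: y. Qed.

Lemma complexImD x y : complex.Im (x + y) = complex.Im x + complex.Im y.
Proof. by case: x; case: y. Qed.

Lemma complexReN x : complex.Re (- x) = - complex.Re x.
Proof. by case: x. Qed.

Lemma complexImN x : complex.Im (- x) = - complex.Im x.
Proof. by case: x. Qed.

Lemma cvg_complex u (a b : R) :
  complex.Re (u n) @[n --> \oo] --> a -> complex.Im (u n) @[n --> \oo] --> b ->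
  u n @[n --> \oo] --> ((a +i* b)%C : R[i]^o).
Proof.
move=> ua ub; apply/cvgrPdist_lt => e e0.
have eE : e = ((complex.Re e)%:C)%C by rewrite RRe_real // gtr0_real.
have e0' : 0 < complex.Re e / 2 by move: e0; rewrite {1}eE ltcR => ?; rewrite divr_gt0.
near=> n; rewrite (le_lt_trans (normc_le_ReIm _)) // eE ltcR /=.
rewrite complexReD complexImD complexReN complexImN /=.
rewrite [ltRHS](splitr (complex.Re e)); apply: ltrD.
  by near: n; move/cvgrPdist_lt: ua; apply.
by near: n; move/cvgrPdist_lt: ub; apply.
Unshelve. all: by end_near. Qed.

Lemma cvg_complex0 u (v : nat -> R) : (forall n, `|u n| <= ((v n)%:C)%C) ->
  v n @[n --> \oo] --> (0 : R) -> u n @[n --> \oo] --> (0 : R[i]^o).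
Proof.
move=> uv v0; apply/cvgrPdist_lt => e e0.
have eE : e = ((complex.Re e)%:C)%C by rewrite RRe_real // gtr0_real.
have e0' : 0 < complex.Re e by move: e0; rewrite {1}eE ltcR.
near=> n; rewrite sub0r normrN (le_lt_trans (uv n)) // eE ltcR.
apply: le_lt_trans (ler_norm _) _; rewrite -normrN -[- _]sub0r.
by near: n; move/cvgrPdist_lt: v0; apply.
Unshelve. all: by end_near. Qed.

(** The real and imaginary parts are each dominated by a real geometric series. *)
Lemma is_cvg_complex_geometric u (c q : R) : 0 <= q < 1 ->
  (forall n, `|u n| <= ((c * q ^+ n)%:C)%C) -> cvgn (series u).
Proof.
move=> /andP[q0 q1] uq.
have cvg_part (f : R[i] -> R) : (forall x y, f (x + y) = f x + f y) ->
    (forall x, (`|f x|%:C)%C <= `|x|) -> cvgn (fun n => f (series u n)).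
  move=> fD fle; have f0 : f 0 = 0 by apply: (@addrI _ (f 0)); rewrite -fD !addr0.
  have -> : (fun n => f (series u n)) = series (fun n => f (u n)).
    apply/funext => n; rewrite /series /=; exact: (big_morph f fD f0).
  apply: normed_cvg; apply: (@series_le_cvg _ _ (geometric c q)) => [n|n|n|].
  - exact: normr_ge0.
  - by rewrite -lecR (le_trans _ (uq n)) ?rmorph0 ?normr_ge0.
  - by rewrite -lecR (le_trans (fle _)) // uq.
  - by apply: is_cvg_geometric_series; rewrite ger0_norm.
have /cvg_ex[a ua] := cvg_part (@complex.Re R) complexReD (@normc_ge_Re R).
have /cvg_ex[b ub] := cvg_part (@complex.Im R) complexImD normc_ge_Im.
apply/cvg_ex; eexists; exact: cvg_complex ua ub.
Qed.

End ComplexCvg.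

(* Q is read as a polynomial in y with coefficients in rat[z].                *)
Theorem theorem1p2 (R : realType) (r N : nat) (hr : (1 <= r)%N)
    (hN : (1 <= N)%N) (P : 'M[group_ring rat (free_group r)]_N) :
  (\forall z \near (0 : R[i]^o), cvgn (green_series P z)) /\
  exists Q : {poly {poly rat}}, Q != 0 /\
    \forall z \near (0 : R[i]^o),
      (map_poly (map_poly (ratr : rat -> R[i])) Q).[green P z, z] = 0.
Proof.
have [rho rho0 Prho] := trace_coef_radius P.
have [Q Q0 QP] := trace_series_algebraic P.
(* Half the radius [rho], as the gain of [2^-1 ^+ m] requires. *)
pose disc (z : R[i]^o) := `|z| <= ratr (rho / 2).
have near_disc : \forall z \near (0 : R[i]^o), disc z.
  apply: nbhs0_le; rewrite ltr0q divr_gt0 //.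
have ratrC (a : rat) : (ratr a : R[i]) = ((ratr a : R)%:C)%C by rewrite fmorph_rat.
have cvg_disc z : disc z -> cvgn (green_series P z).
  move=> zrho; apply: (@is_cvg_complex_geometric _ _ N%:R 2^-1) => [|n].
    by rewrite invr_ge0 ler0n invf_lt1 ?ltr1n.
  have -> : ((N%:R * 2^-1 ^+ n : R)%:C)%C = ratr (N%:R * 2^-1 ^+ n).
    by rewrite ratrC; congr (_%:C)%C; rewrite rmorphM /= !rmorph_nat rmorphXn fmorphV rmorph_nat.
  have zrho' : `|z| <= ratr rho.
    by rewrite (le_trans zrho) // ler_rat ler_pdivrMr // mulr_natr mulr2n lerDl ltW.
  apply: le_trans (_ : ratr (`|trace_coef P n| * rho ^+ n) <= _); last by rewrite ler_rat.
  rewrite normrM normrX rmorphM rmorphXn /= ratr_norm ler_wpM2l // lerXn2r ?nnegrE ?normr_ge0 //.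
  exact: le_trans zrho'.
split; first exact: filterS cvg_disc near_disc.
exists Q; split=> //; apply: filterS near_disc => z zrho.
pose p m := \poly_(n < m) trace_coef P n.
have green_pE m : green_series P z m = (map_poly ratr (p m)).[z].
  rewrite /green_series /series /= big_mkord (@horner_coef_wide _ m); last first.
    by rewrite size_map_poly; apply: size_poly.
  by apply: eq_bigr => n _; rewrite coef_map coef_poly ltn_ord.
pose q := map_poly (horner_eval (z : R[i])) (map_poly (map_poly (ratr : rat -> R[i])) Q).
have qE (y : R[i]) : (map_poly (map_poly (ratr : rat -> R[i])) Q).[y, z] = q.[y].
  by rewrite -horner_evalE -horner_map /= horner_evalE hornerC.
rewrite qE; pose c := \sum_(i < size Q) poly_norm rho Q`_i * (N%:R * 2) ^+ i.
(* At the truncation [p m], the value of [Q] is divisible by ['X^m] and has norm at most [c],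
   whatever [m] is. *)
have q_green m : `|q.[green_series P z m]| <= ((ratr c * 2^-1 ^+ m : R)%:C)%C.
  have [S SE] := QP m.
  have -> : q.[green_series P z m] = (map_poly ratr Q.[p m]).[z].
    by rewrite green_pE -[LHS]/(q.[horner_eval z _]) horner_map /= horner_evalE horner_map.
  apply: le_trans (poly_norm_ratr_Xn rho0 SE zrho) _.
  have -> : ratr c * 2^-1 ^+ m = ratr (2^-1 ^+ m * c) :> R.
    by rewrite rmorphM rmorphXn fmorphV rmorph_nat mulrC.
  rewrite ratrC lecR ler_rat ler_wpM2l ?exprn_ge0 //.
  by apply: poly_norm_horner; [apply: ltW|apply: trace_poly_norm].
have q0 : (q.[green_series P z m] : R[i]^o) @[m --> \oo] --> (0 : R[i]^o).
  apply: cvg_complex0 q_green _.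
  by apply: cvg_geometric; rewrite ger0_norm ?invr_ge0 // invf_lt1 ?ltr1n.
(* By continuity the same sequence tends to [q] evaluated at [green P z], which is therefore 0. *)
have qG := @cvg_horner _ q _ _ (cvg_disc z zrho).
exact: cvg_unique qG q0.
Qed.
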